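(* Let $G$ and $H$ be finite simple graphs, and let $G[H]$ denote their lexicographical product. (a) Suppose that $G$ is a graph of isolated vertices (i.e. $G$ has no edges). Then ${\rm Ind}(H)$ is vertex decomposable, respectively shellable, if and only if ${\rm Ind}(G[H])$ is vertex decomposable, respectively shellable. (b) Suppose that $G$ is not a graph of isolated vertices (i.e. $G$ has at least one edge). Then ${\rm Ind}(G[H])$ is vertex decomposable if and only if ${\rm Ind}(G)$ is vertex decomposable and $H = K_m$ for some $m \geq 1$. (c) Suppose that $G$ is not a graph of isolated vertices. If ${\rm Ind}(G)$ is shellable and $H = K_m$, then ${\rm Ind}(G[H])$ is shellable. Furthermore, if ${\rm Ind}(G[H])$ is shellable, then $H = K_m$ for some $m \geq 1$.
   Context: For graphs $G=(V_G,E_G)$ and $H=(V_H,E_H)$, the lexicographical product $G[H]$ is the graph with vertex set $V_G\times V_H$ in which $(w,x)$ and $(y,z)$ are adjacent if $\{w,y\}\in E_G$, or if $w=y$ and $\{x,z\}\in E_H$. $K_m$ denotes the complete graph on $m$ vertices. A set $W\subseteq V_G$ is independent if no edge of $G$ is contained in $W$; the independence complex ${\rm Ind}(G)$ is the simplicial complex of all independent sets of $G$. Facets are maximal faces; a complex is pure if all facets have the same dimension. A pure simplicial complex $\Delta$ is shellable if its facets can be ordered $F_1,\ldots,F_s$ so that for all $1\le j<i\le s$ there exist $x\in F_i\setminus F_j$ and $k\in\{1,\ldots,i-1\}$ with $\{x\}=F_i\setminus F_k$. For a vertex $x$, ${\rm del}_\Delta(x)=\{G\in\Delta : x\notin G\}$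 and ${\rm link}_\Delta(x)=\{G\in\Delta: x\notin G,\ G\cup\{x\}\in\Delta\}$. A pure simplicial complex $\Delta$ is vertex decomposable if either $\Delta$ is a simplex (has a unique facet), or there is a vertex $x$ such that ${\rm del}_\Delta(x)$ and ${\rm link}_\Delta(x)$ are vertex decomposable. *)

(* Defs.v *)
From HB Require Import structures.
From mathcomp Require Import all_boot.

Set Implicit Arguments.
Unset Strict Implicit.
Unset Printing Implicit Defensive.

Record sgraph := SGraph {
  vertices :> finType;
  adj : rel vertices;
  adj_sym : symmetric adj;
  adj_irr : irreflexive adj
}.

Definition isolated (G : sgraph) : Prop := forall x y : G, ~~ adj x y.

Definition graph_iso (G H : sgraph) : Prop :=
  exists2 f : G -> H, bijective f & forall x y : G, adj (f x) (f y) = adj x y.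

Definition complete_adj (m : nat) : rel 'I_m := fun x y => x != y.

Lemma complete_adj_sym m : symmetric (@complete_adj m).
Proof. by move=> x y; rewrite /complete_adj eq_sym. Qed.

Lemma complete_adj_irr m : irreflexive (@complete_adj m).
Proof. by move=> x; rewrite /complete_adj eqxx. Qed.

Definition complete_graph (m : nat) : sgraph :=
  SGraph (@complete_adj_sym m) (@complete_adj_irr m).

Definition lex_adj (G H : sgraph) : rel (G * H)%type :=
  fun u v => adj u.1 v.1 || (u.1 == v.1) && adj u.2 v.2.

Lemma lex_adj_sym (G H : sgraph) : symmetric (@lex_adj G H).
Proof.
by move=> u v; rewrite /lex_adj adj_sym eq_sym [in X in _ && X]adj_sym.
Qed.

Lemma lex_adj_irr (G H : sgraph) : irreflexive (@lex_adj G H).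
Proof. by move=> u; rewrite /lex_adj !adj_irr andbF. Qed.

Definition lex_product (G H : sgraph) : sgraph :=
  SGraph (@lex_adj_sym G H) (@lex_adj_irr G H).

(* A simplicial complex is given by its set of faces. An element of [T] need
   not be a vertex of the complex: the vertices of [D] are the [x] such that
   [[set x] \in D]. In this way deletions and links live on the same type. *)
Definition simplicial_complex (T : finType) (D : {set {set T}}) : Prop :=
  forall A B : {set T}, A \subset B -> B \in D -> A \in D.

Definition independent (G : sgraph) (W : {set G}) : bool :=
  [forall x in W, forall y in W, ~~ adj x y].

Definition Ind (G : sgraph) : {set {set G}} := [set W | independent W].

Definition facets (T : finType) (D : {set {set T}}) : {set {set T}} :=
  [set F | maxset (fun A : {set T} => A \in D) F].

Definition pure (T : finType) (D : {set {set T}}) : Prop :=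
  forall F F' : {set T}, F \in facets D -> F' \in facets D -> #|F| = #|F'|.

Definition shellable (T : finType) (D : {set {set T}}) : Prop :=
  pure D /\
  exists s : seq {set T},
    [/\ uniq s, s =i facets D &
      forall i j : nat, j < i -> i < size s ->
        exists2 x : T, x \in nth set0 s i :\: nth set0 s j &
        exists2 k : nat, k < i & nth set0 s i :\: nth set0 s k = [set x]].

Definition simplex (T : finType) (D : {set {set T}}) : Prop := #|facets D| = 1.

Definition del (T : finType) (D : {set {set T}}) (x : T) : {set {set T}} :=
  [set A in D | x \notin A].

Definition link (T : finType) (D : {set {set T}}) (x : T) : {set {set T}} :=
  [set A in D | (x \notin A) && (x |: A \in D)].

Inductive vertex_decomposable (T : finType) (D : {set {set T}}) : Prop :=
| vd_simplex of pure D & simplex D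
| vd_shed (x : T) of pure D & [set x] \in D &
    vertex_decomposable (del D x) & vertex_decomposable (link D x).

Lemma simplicial_complex_Ind (G : sgraph) : simplicial_complex (Ind G).
Proof.
move=> A B /subsetP sAB; rewrite !inE => /forall_inP indB.
apply/forall_inP => x /sAB xB; apply/forall_inP => y /sAB yB.
by have /forall_inP/(_ y yB) := indB x xB.
Qed.

Lemma simplicial_complex_del (T : finType) (D : {set {set T}}) (x : T) :
  simplicial_complex D -> simplicial_complex (del D x).
Proof.
move=> cD A B sAB; rewrite !inE => /andP[DB xB].
by rewrite (cD _ _ sAB DB) (contra (subsetP sAB x) xB).
Qed.

Lemma simplicial_complex_link (T : finType) (D : {set {set T}}) (x : T) :
  simplicial_complex D -> simplicial_complex (link D x).
Proof.
move=> cD A B sAB; rewrite !inE => /and3P[DB xB DxB].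
by rewrite (cD _ _ sAB DB) (contra (subsetP sAB x) xB) (cD _ _ (setUS _ sAB)).
Qed.

(* Main.v *)
(** If [G] has no edges, [Ind (G[H])] is a join of copies of [Ind H], and if [H]
    is complete, [Ind (G[H])] is the blow-up of [Ind G] in which every vertex is
    replaced by [#|H|] pairwise non-adjacent copies.  Deletions and links of
    joins and blow-ups are again joins and blow-ups, which handles vertex
    decomposability by induction; shellings are transported by ordering the
    facets with a suitable numerical rank.

    For the necessity of [H = K_m], suppose that [h1 <> h2] are not adjacent and
    that [Ind (G[H])] is shellable.  Purity implies that no nonempty fiber
    (over a vertex of [G]) of a facet is a singleton, so two facets differing in
    one point have the same projection to [G].  Along a shelling all facets thus
    have the same projection, which is absurd if [G] has an edge. *)

Require Import Defs.
From mathcomp Require Import all_boot.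

Set Implicit Arguments.
Unset Strict Implicit.
Unset Printing Implicit Defensive.

(** * Facets, deletions and links *)

Section Facets.
Variable T : finType.
Implicit Types (D : {set {set T}}) (A F : {set T}) (x : T).

Lemma facetP D F :
  reflect (F \in D /\ forall A, A \in D -> F \subset A -> A = F)
          (F \in facets D).
Proof. by rewrite inE; apply: maxsetP. Qed.

Lemma facet_mem D F : F \in facets D -> F \in D.
Proof. by case/facetP. Qed.

Lemma facet_exists D A : A \in D -> exists2 F, F \in facets D & A \subset F.
Proof.
move=> DA; have [F maxF sAF] := @maxset_exists _ (fun B => B \in D) A DA.
by exists F => //; rewrite inE.
Qed.

Lemma leq_card_facet D F A :
  pure D -> F \in facets D -> A \in D -> #|A| <= #|F|.
Proof.
move=> pD fF /facet_exists[F' fF' sAF'].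
by rewrite (pD F F' fF fF') subset_leq_card.
Qed.

Lemma facet_of_card D F A :
  pure D -> F \in facets D -> A \in D -> #|F| <= #|A| -> A \in facets D.
Proof.
move=> pD fF /facet_exists[F' fF' sAF'] leFA.
suff -> : A = F' by [].
by apply/eqP; rewrite eqEcard sAF' -(pD F F' fF fF').
Qed.

Lemma mem_del D x A : (A \in del D x) = (A \in D) && (x \notin A).
Proof. by rewrite inE. Qed.

Lemma mem_link D x A :
  simplicial_complex D -> (A \in link D x) = (x \notin A) && (x |: A \in D).
Proof.
move=> cD; rewrite inE; case: (boolP (x |: A \in D)) => [DxA|]; last first.
  by rewrite !andbF.
by rewrite (cD _ _ (subsetUr _ _) DxA).
Qed.

Lemma facet_del D x F : F \in facets D -> x \notin F -> F \in facets (del D x).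
Proof.
case/facetP=> DF maxF xF; apply/facetP; split; first by rewrite mem_del DF.
by move=> A; rewrite mem_del => /andP[DA _]; apply: maxF.
Qed.

Lemma facet_link D x F : simplicial_complex D ->
  F \in facets D -> x \in F -> F :\ x \in facets (link D x).
Proof.
move=> cD /facetP[DF maxF] xF; apply/facetP; split.
  by rewrite mem_link // setD11 setD1K.
move=> A; rewrite mem_link // => /andP[xA DxA] sFA.
by rewrite -(maxF (x |: A)) ?setU1K // -(setD1K xF) setUS.
Qed.

Lemma facet_of_link D x F : simplicial_complex D ->
  F \in facets (link D x) -> x |: F \in facets D.
Proof.
move=> cD /facetP[]; rewrite mem_link // => /andP[xF DxF] maxF.
apply/facetP; split=> // A DA sFA.
have xA : x \in A by apply: (subsetP sFA); rewrite setU11.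
rewrite -(setD1K xA) (maxF (A :\ x)) //.
  by rewrite mem_link // setD11 setD1K.
by rewrite -(setU1K xF) setSD.
Qed.

Lemma facets_set0 : facets [set set0] = [set (set0 : {set T})].
Proof.
apply/setP=> F; rewrite in_set1; apply/facetP/eqP => [[]|->].
  by rewrite in_set1 => /eqP.
by rewrite in_set1; split=> // A; rewrite in_set1 => /eqP.
Qed.

Lemma facets_powerset A : facets (powerset A) = [set A].
Proof.
apply/setP=> F; rewrite in_set1; apply/facetP/eqP => [[]|->].
  by rewrite powersetE => sFA /(_ A) <- //; rewrite powersetE.
rewrite powersetE; split=> // B; rewrite powersetE => sBA sAB.
by apply/eqP; rewrite eqEsubset sBA.
Qed.

Lemma simplex_powerset D : simplicial_complex D -> simplex D ->
  exists A, D = powerset A.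
Proof.
move=> cD /eqP/cards1P[F fD]; exists F; apply/setP=> A; rewrite powersetE.
apply/idP/idP => [/facet_exists[F']|sAF]; first by rewrite fD inE => /eqP->.
by apply: cD sAF _; apply: facet_mem; rewrite fD set11.
Qed.

Lemma simplex_pure D : simplex D -> pure D.
Proof. by move=> /eqP/cards1P[F fD] A B; rewrite fD !inE => /eqP-> /eqP->. Qed.

End Facets.

(** * Vertex decomposability and an induction principle for it *)

Section VertexDecomposable.
Variable T : finType.
Implicit Types (D : {set {set T}}) (A F : {set T}) (x : T).

Lemma vd_pure D : vertex_decomposable D -> pure D.
Proof. by case. Qed.

Lemma simplex_vd D : simplex D -> vertex_decomposable D.
Proof. by move=> sD; apply: vd_simplex => //; apply: simplex_pure. Qed.

Lemma vd_set0 : vertex_decomposable [set (set0 : {set T})].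
Proof. by apply: simplex_vd; rewrite /simplex facets_set0 cards1. Qed.

(* A simplex is a repeated cone over the complex [{set0}], so in inductions
   that complex can serve as the only base case. *)
Lemma vd_ind0 (P : {set {set T}} -> Prop) :
    P [set set0] ->
    (forall D x, simplicial_complex D -> pure D -> [set x] \in D ->
       vertex_decomposable (del D x) -> P (del D x) ->
       vertex_decomposable (link D x) -> P (link D x) -> P D) ->
  forall D, simplicial_complex D -> vertex_decomposable D -> P D.
Proof.
move=> P0 Pshed D cD vD; elim: vD cD => {}D.
  move=> _ sD cD; have [A ->] := simplex_powerset cD sD => {D sD cD}.
  have [n] := ubnP #|A|; elim: n A => // n IHn A leAn.
  have [->|[x xA]] := set_0Vmem A; first by rewrite powerset0.
  have vdP (B : {set T}) : vertex_decomposable (powerset B).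
    by apply: simplex_vd; rewrite /simplex facets_powerset cards1.
  have ltA : #|A :\ x| < n by move: leAn; rewrite (cardsD1 x A) xA.
  have cA : simplicial_complex (powerset A).
    by move=> B C sBC; rewrite !powersetE; apply: subset_trans.
  have delE : del (powerset A) x = powerset (A :\ x).
    by apply/setP=> B; rewrite mem_del !powersetE subsetD1.
  have linkE : link (powerset A) x = powerset (A :\ x).
    apply/setP=> B; rewrite mem_link // !powersetE subsetD1 subUset sub1set xA.
    by rewrite andbC.
  apply: (Pshed (powerset A) x) => //; rewrite ?delE ?linkE //.
  - exact: vd_pure.
  - by rewrite powersetE sub1set.
  - exact: IHn.
  - exact: IHn.
move=> x pD Dx vdel IHdel vlink IHlink cD; apply: (Pshed D x) => //.
  by apply: IHdel; apply: simplicial_complex_del.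
by apply: IHlink; apply: simplicial_complex_link.
Qed.

End VertexDecomposable.

(** * Shellings described by numerical ranks *)

Section Shellable.
Variable T : finType.
Implicit Types (D : {set {set T}}) (A F : {set T}) (x : T).

(** A shelling recorded by a number per facet instead of a list. Two facets of equal rank must
    satisfy the exchange condition in both directions, while the facet [F''] realising it must have
    strictly smaller rank. *)
Definition shelling_rank D (r : {set T} -> nat) : Prop :=
  forall F F', F \in facets D -> F' \in facets D -> F != F' -> r F' <= r F ->
  exists2 x, x \in F :\: F' &
  exists F'', [/\ F'' \in facets D, r F'' < r F & F :\: F'' = [set x]].

(* Facets of equal rank may be listed in any order. *)
Lemma shellableP D :
  shellable D <-> pure D /\ exists r, shelling_rank D r.
Proof.
split=> [[pD [s [us sE shell]]]|[pD [r shell]]]; split=> //.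
  exists (fun F => index F s) => F F'; rewrite -!sE => sF sF' neqF le_r.
  have lt_r : index F' s < index F s.
    rewrite ltn_neqAle le_r andbT; apply: contraNneq neqF => eq_r.
    by rewrite -(nth_index set0 sF) -(nth_index set0 sF') eq_r.
  have := shell _ _ lt_r; rewrite index_mem sF !nth_index // => /(_ isT).
  case=> x xF [k ltk eqk]; exists x => //; exists (nth set0 s k).
  have ltks : k < size s by rewrite (ltn_trans ltk) // index_mem.
  by rewrite -sE mem_nth // index_uniq.
pose le_r := [rel F F' | r F <= r F'].
have tr_r : transitive le_r by move=> A B C; apply: leq_trans.
have tot_r : total le_r by move=> A B; apply: leq_total.
pose s := sort le_r (enum (facets D)).
have sE : s =i facets D by move=> F; rewrite mem_sort mem_enum.
have us : uniq s by rewrite sort_uniq enum_uniq.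
exists s; split=> // i j ltji ltis; have ltjs := ltn_trans ltji ltis.
have sorted_s k l : k < l -> l < size s -> r (nth set0 s k) <= r (nth set0 s l).
  move=> ltkl ltls; apply: (sorted_ltn_nth tr_r) => //; last first.
  - exact: (ltn_trans ltkl).
  - exact: sort_sorted.
have [||||x xij [F'' [fF'' ltF'' eqF'']]] :=
    shell (nth set0 s i) (nth set0 s j).
- by rewrite -sE mem_nth.
- by rewrite -sE mem_nth.
- by rewrite nth_uniq // gtn_eqF.
- exact: sorted_s.
exists x => //; exists (index F'' s); last by rewrite nth_index // sE.
have sF'' : F'' \in s by rewrite sE.
rewrite ltnNge; apply: contraL ltF''; rewrite leq_eqVlt -leqNgt.
case/predU1P=> [->|lti]; first by rewrite nth_index.
by rewrite -(nth_index set0 sF'') sorted_s // index_mem.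
Qed.

(* Shell the deletion first, then the cone over the link. *)
Lemma vd_shellable D :
  simplicial_complex D -> vertex_decomposable D -> shellable D.
Proof.
move=> cD vD; apply/shellableP; split; first exact: vd_pure.
move: D cD vD; apply: vd_ind0 => [|D x cD pD Dx vdel [rd shd] _ [rl shl]].
  exists (fun=> 0) => F F'; rewrite facets_set0 !in_set1 => /eqP-> /eqP->.
  by rewrite eqxx.
(* [M] exceeds every rank of the deletion, so adding it places all facets through [x] after those
   avoiding it. *)
pose M := (\max_(F : {set T}) rd F).+1.
have ltM F : rd F < M by rewrite ltnS (bigop.leq_bigmax F).
(* The facet [F] avoiding [x] is also a facet of the deletion, so purity of the deletion gives [F']
   the size of a facet of [D]. *)
have del_facet F F' : F \in facets D -> x \notin F ->
    F' \in facets (del D x) -> F' \in facets D.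
  move=> fF xF fF'; apply: (facet_of_card pD fF).
    by have := facet_mem fF'; rewrite mem_del => /andP[].
  by rewrite (vd_pure vdel fF' (facet_del fF xF)).
exists (fun F => if x \in F then M + rl (F :\ x) else rd F) => F F' fF fF' neqF.
have [xF|xF] := boolP (x \in F); have [xF'|xF'] := boolP (x \in F').
- rewrite leq_add2l => le_r.
  have [|||//|y yF [G [fG lt_r eqG]]] := shl (F :\ x) (F' :\ x).
  + exact: facet_link.
  + exact: facet_link.
  + by apply: contraNneq neqF => eqF; rewrite -(setD1K xF) eqF setD1K.
  have xG : x \notin G.
    by have := facet_mem fG; rewrite mem_link // => /andP[].
  exists y; first by move: yF; rewrite !inE; case: (y == x); rewrite ?andbF.
  exists (x |: G); rewrite setU11 setU1K // ltn_add2l facet_of_link //.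
  split=> //; rewrite -eqG; apply/setP=> z; rewrite !inE.
  by case: (z == x); rewrite ?andbF.
- move=> _; exists x; first by rewrite inE xF xF'.
  (* As [F'] avoids [x], a facet of the deletion containing [F :\ x] is a facet of [D]. It precedes
     [F] and misses only [x]. *)
  have [|F'' fF'' sF] := @facet_exists _ (del D x) (F :\ x).
    by rewrite mem_del setD11 (cD _ _ (subD1set _ _) (facet_mem fF)).
  have xF'' : x \notin F'' by have := facet_mem fF''; rewrite mem_del => /andP[].
  exists F''; rewrite (negPf xF'') (leq_trans (ltM _) (leq_addr _ _)).
  split=> //; first exact: (del_facet F').
  apply/setP=> y; rewrite !inE; have [->|neqy] := eqVneq y x; first by rewrite xF''.
  have [yF|yF] := boolP (y \in F); last by rewrite andbF.
  by rewrite (subsetP sF) // !inE neqy.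
- by move=> /(leq_trans (leq_addr _ _)); rewrite leqNgt ltM.
move=> le_r; have [//|//|y yF [F'' [fF'' lt_r eqF'']]] :=
  shd F F' (facet_del fF xF) (facet_del fF' xF').
exists y => //; exists F''.
have xF'' : x \notin F'' by have := facet_mem fF''; rewrite mem_del => /andP[].
by rewrite (negPf xF''); split=> //; apply: (del_facet F).
Qed.

End Shellable.

(** * Blow-ups of a complex along a map of vertices *)

Section Blowup.
Variables (X V : finType) (p : X -> V).
Implicit Types (S A : {set X}) (E : {set {set V}}) (B : {set V}).

(* Each vertex [v] of [E] is replaced by the pairwise non-adjacent vertices of
   [S] above [v]. *)
Definition blowup S E : {set {set X}} :=
  [set A : {set X} | [&& A \subset S,
             [forall x in A, forall y in A, (p x == p y) ==> (x == y)]
             & p @: A \in E]].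

Lemma blowupP S E A :
  reflect [/\ A \subset S, {in A &, injective p} & p @: A \in E]
          (A \in blowup S E).
Proof.
rewrite inE; apply: (iffP and3P) => [[sA injA EA]|[sA injA EA]]; split=> //.
  move=> x y xA yA eqp; have /forall_inP/(_ y yA) := forall_inP injA x xA.
  by rewrite eqp eqxx => /eqP.
apply/forall_inP=> x xA; apply/forall_inP=> y yA; apply/implyP=> /eqP eqp.
by apply/eqP; apply: injA.
Qed.

Lemma simplicial_complex_blowup S E :
  simplicial_complex E -> simplicial_complex (blowup S E).
Proof.
move=> cE A A' sAA' /blowupP[sA' injA' EA']; apply/blowupP; split.
- exact: subset_trans sA'.
- by move=> x y /(subsetP sAA') xA /(subsetP sAA') yA; apply: injA'.
- by apply: cE EA'; apply: imsetS.
Qed.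

Lemma imsetU1 x A : p @: (x |: A) = p x |: p @: A.
Proof. by rewrite imsetU imset_set1. Qed.

Lemma in_inj_setU1 x A : p x \notin p @: A -> {in A &, injective p} ->
  {in x |: A &, injective p}.
Proof.
move=> pxA injA y z; rewrite !inE => /predU1P[->|yA] /predU1P[->|zA] //.
- by move=> eqp; case/negP: pxA; rewrite eqp imset_f.
- by move=> eqp; case/negP: pxA; rewrite -eqp imset_f.
- exact: injA.
Qed.

Lemma blowup_setU1 S E x A : x \in S -> p x \notin p @: A ->
  A \in blowup S E -> p x |: p @: A \in E -> x |: A \in blowup S E.
Proof.
move=> xS pxA /blowupP[sA injA _] Ex; apply/blowupP; split.
- by rewrite subUset sub1set xS.
- exact: in_inj_setU1.
- by rewrite imsetU1.
Qed.

(** A face containing [A], maximal among those projecting into [B], must cover [B]: above a missed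
    vertex, [S] has a point that could be added. *)
Lemma blowup_lift S E A B : simplicial_complex E ->
    (forall C, C \in E -> C \subset p @: S) ->
    A \in blowup S E -> B \in E -> p @: A \subset B ->
  exists A', [/\ A' \in blowup S E, A \subset A' & p @: A' = B].
Proof.
move=> cE ES DA EB sAB.
have [|A' /maxsetP[/andP[DA' sA'B] maxA'] sAA'] :=
    @maxset_exists _ (fun C => (C \in blowup S E) && (p @: C \subset B)) A.
  by rewrite DA sAB.
exists A'; split=> //; apply/eqP; rewrite eqEsubset sA'B.
apply/subsetP=> v vB; apply: contraT => vA'.
have /imsetP[x xS vx] := subsetP (ES _ EB) v vB.
have sxB : p x |: p @: A' \subset B by rewrite subUset sub1set -vx vB.
have /maxA'/(_ (subsetUr _ _)) eqA' :
    (x |: A' \in blowup S E) && (p @: (x |: A') \subset B).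
  by rewrite imsetU1 sxB blowup_setU1 -?vx // vx (cE _ _ sxB).
by case/negP: vA'; rewrite vx imset_f // -eqA' setU11.
Qed.

Lemma set0_blowup S E : set0 \in E -> set0 \in blowup S E.
Proof.
move=> E0; apply/blowupP; rewrite sub0set imset0.
by split=> // x y; rewrite inE.
Qed.

(** An enlargement of the projection lifts to an enlargement of [A]. Conversely, [p] is injective on
    faces, so sizes can be compared after projection. *)
Lemma facet_blowup S E A : simplicial_complex E ->
    (forall C, C \in E -> C \subset p @: S) ->
  (A \in facets (blowup S E)) = (A \in blowup S E) && (p @: A \in facets E).
Proof.
move=> cE ES; apply/facetP/andP => [[DA maxA]|[DA /facetP[EA maxA]]]; split=> //.
  apply/facetP; split=> [|B EB sAB]; first by case/blowupP: DA.
  have [A' [DA' sAA' <-]] := blowup_lift cE ES DA EB sAB.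
  by rewrite (maxA A').
move=> A' /blowupP[sA' injA' EA'] sAA'.
have [_ injA _] := blowupP _ _ _ DA.
apply/esym/eqP; rewrite eqEcard sAA' -(card_in_imset injA) -(card_in_imset injA').
by rewrite (maxA _ EA' (imsetS p sAA')) leqnn.
Qed.

Lemma blowup_lift0 S E B : simplicial_complex E ->
    (forall C, C \in E -> C \subset p @: S) -> B \in E ->
  exists2 A, A \in blowup S E & p @: A = B.
Proof.
move=> cE ES EB; have E0 : set0 \in E by apply: cE EB; apply: sub0set.
have [|A [DA _ eqA]] := blowup_lift cE ES (set0_blowup S E0) EB.
  by rewrite imset0 sub0set.
by exists A.
Qed.

Lemma pure_blowup S E : simplicial_complex E ->
  (forall C, C \in E -> C \subset p @: S) -> pure (blowup S E) <-> pure E.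
Proof.
move=> cE ES; split=> pE F F'; last first.
  rewrite !facet_blowup // => /andP[/blowupP[_ inF _] fF] /andP[/blowupP[_ inF' _] fF'].
  by rewrite -(card_in_imset inF) -(card_in_imset inF'); apply: pE.
move=> fF fF'.
have [A DA eA] := blowup_lift0 cE ES (facet_mem fF).
have [A' DA' eA'] := blowup_lift0 cE ES (facet_mem fF').
have /blowupP[_ inA _] := DA; have /blowupP[_ inA' _] := DA'.
rewrite -eA -eA' !card_in_imset //.
by apply: pE; rewrite facet_blowup // (DA, DA') (eA, eA').
Qed.

Lemma del_blowup S E x : del (blowup S E) x = blowup (S :\ x) E.
Proof.
apply/setP=> A; rewrite mem_del; apply/andP/blowupP.
  by case=> /blowupP[sA injA EA] xA; rewrite subsetD1 sA.
by rewrite subsetD1 => -[/andP[sA xA] injA EA]; split=> //; apply/blowupP.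
Qed.

(** A face containing [x] has no other point above [p x], so the whole fiber of [x] leaves the
    vertex set. *)
Lemma link_blowup S E x : simplicial_complex E -> x \in S ->
  link (blowup S E) x = blowup [set y in S | p y != p x] (link E (p x)).
Proof.
move=> cE xS; have cD := @simplicial_complex_blowup S E cE.
apply/setP=> A; rewrite mem_link //; apply/andP/blowupP.
  case=> xA DxA; have /blowupP[sxA injxA ExA] := DxA.
  have /blowupP[sA injA EA] := cD _ _ (subsetUr [set x] A) DxA.
  have neqA y : y \in A -> p y != p x.
    move=> yA; apply: contraNneq xA => eqp.
    by rewrite -(injxA _ _ _ _ eqp) // !inE ?yA ?eqxx ?orbT.
  split=> //; first by apply/subsetP=> y yA; rewrite inE (subsetP sA) // neqA.
  rewrite mem_link // -imsetU1 ExA andbT.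
  by apply/imsetP=> -[y /neqA/eqP neq eq]; apply: neq.
rewrite mem_link // => -[/subsetP sA injA /andP[pxA Ex]].
have xA : x \notin A by apply: contra pxA; apply: imset_f.
split=> //; apply: blowup_setU1 => //; apply/blowupP; split=> //.
  by apply/subsetP=> y /sA; rewrite inE => /andP[].
by apply: cE Ex; apply: subsetUr.
Qed.

Lemma blowup_del S E v : v \notin p @: S -> blowup S (del E v) = blowup S E.
Proof.
move=> vS; apply/setP=> A; apply/blowupP/blowupP => -[sA injA].
  by rewrite mem_del => /andP[EA _].
move=> EA; rewrite mem_del EA; split=> //.
by apply: contra vS; apply: subsetP (imsetS _ sA) v.
Qed.

Lemma del_sub_imset S E x : p x \notin p @: (S :\ x) ->
  (forall C, C \in E -> C \subset p @: S) ->
  forall C, C \in del E (p x) -> C \subset p @: (S :\ x).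
Proof.
move=> px ES C; rewrite mem_del => /andP[/ES/subsetP sC xC].
apply/subsetP=> v vC; have /imsetP[y yS eqv] := sC v vC.
rewrite eqv imset_f // !inE yS andbT; apply: contraNneq xC => <-.
by rewrite -eqv.
Qed.

Lemma link_sub_imset S E v : simplicial_complex E ->
  (forall C, C \in E -> C \subset p @: S) ->
  forall C, C \in link E v -> C \subset p @: [set y in S | p y != v].
Proof.
move=> cE ES C; rewrite mem_link // => /andP[vC EvC].
apply/subsetP=> w wC.
have /imsetP[y yS eqw] := subsetP (ES _ EvC) w (setU1r _ wC).
rewrite eqw imset_f // !inE yS; apply: contraNneq vC => <-.
by rewrite -eqw.
Qed.

Lemma imset_setD1_id S x : p x \in p @: (S :\ x) -> p @: S \subset p @: (S :\ x).
Proof.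
move=> px; apply/subsetP=> _ /imsetP[y yS ->].
by have [->|neq] := eqVneq y x; last by rewrite imset_f // !inE neq.
Qed.

(** Induction on the decomposition of the blow-up, with shedding vertex [x]. If another point lies
    above [p x], the deletion is still a blow-up of [E] itself. Otherwise deletion and link are
    blow-ups of those of [E] at [p x], which is then shed from [E]. *)
Lemma vd_blowup_base S E : simplicial_complex E ->
    (forall C, C \in E -> C \subset p @: S) ->
  vertex_decomposable (blowup S E) -> vertex_decomposable E.
Proof.
move=> cE ES vD; have cD := @simplicial_complex_blowup S E cE.
move: {-1}(blowup S E) (erefl (blowup S E)) cD vD => D eqD cD vD.
move: D cD vD S E eqD cE ES.
apply: vd_ind0 => [|D x _ pD Dx _ IHdel _ IHlink] S E eqD cE ES.
  suff -> : E = [set set0] by apply: vd_set0.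
  apply/setP=> B; rewrite in_set1; apply/idP/eqP => [EB|->].
    have [A DA <-] := blowup_lift0 cE ES EB.
    by move: DA; rewrite eqD in_set1 => /eqP->; rewrite imset0.
  have : set0 \in blowup S E by rewrite eqD set11.
  by case/blowupP; rewrite imset0.
rewrite -{}eqD in pD Dx IHdel IHlink.
have /blowupP[] := Dx; rewrite sub1set imset_set1 => xS _ Ex.
have := IHdel _ _ (esym (del_blowup S E x)).
have [px /(_ cE) IH|px _] := boolP (p x \in p @: (S :\ x)).
  by apply: IH => C /ES sC; apply: subset_trans sC (imset_setD1_id px).
apply: (@vd_shed _ _ (p x)) => //; first exact/(pure_blowup cE ES).
  apply: (IHdel (S :\ x)); first by rewrite blowup_del // del_blowup.
    exact: simplicial_complex_del.
  exact: del_sub_imset.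
apply: (IHlink [set y in S | p y != p x]); first by rewrite link_blowup.
  exact: simplicial_complex_link.
exact: link_sub_imset.
Qed.

Lemma blowup_set0 S : blowup S [set set0] = [set set0].
Proof.
apply/setP=> A; rewrite in_set1; apply/blowupP/eqP => [[_ _]|->].
  by rewrite in_set1 imset_eq0 => /eqP.
by rewrite sub0set imset0 set11; split=> // x y; rewrite inE.
Qed.

(* Shed the points above a shedding vertex [v] of [E] one after the other: all
   of them have a blow-up of [link E v] as link, and once they are gone what is
   left is a blow-up of [del E v]. *)
Lemma vd_blowup S E : simplicial_complex E ->
    (forall C, C \in E -> C \subset p @: S) ->
  vertex_decomposable E -> vertex_decomposable (blowup S E).
Proof.
move=> cE ES vE.
move: E cE vE S ES; apply: vd_ind0 => [|E v cE pE Ev _ IHdel _ IHlink] S ES.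
  by rewrite blowup_set0; apply: vd_set0.
have [n] := ubnP #|S|; elim: n S ES => // n IHn S ES leSn.
have /imsetP[x xS eqv] : v \in p @: S by rewrite -sub1set ES.
rewrite {}eqv in Ev IHdel IHlink.
apply: (@vd_shed _ _ x).
- exact/(pure_blowup cE ES).
- apply/blowupP; rewrite sub1set imset_set1; split=> //.
  by move=> y z; rewrite !inE => /eqP-> /eqP->.
- rewrite del_blowup; have [px|px] := boolP (p x \in p @: (S :\ x)).
    apply: IHn => [C /ES sC|]; first exact: subset_trans sC (imset_setD1_id px).
    by move: leSn; rewrite (cardsD1 x S) xS.
  by rewrite -(blowup_del _ px); apply: IHdel; apply: del_sub_imset.
- by rewrite link_blowup //; apply: IHlink; apply: link_sub_imset.
Qed.

(* Order first by the base facet, then by the sum of the positions of the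
   chosen points. *)
Lemma shellable_blowup S E : simplicial_complex E ->
    (forall C, C \in E -> C \subset p @: S) ->
  shellable E -> shellable (blowup S E).
Proof.
move=> cE ES /shellableP[pE [r sh]]; apply/shellableP.
split; first exact/(pure_blowup cE ES).
pose c (x : X) : nat := enum_rank x.
have c_inj : injective c by move=> x y /val_inj/enum_rank_inj.
pose w (A : {set X}) := \sum_(x in A) c x.
(* As [M] exceeds all weights, [r (p @: A) * M + w A] compares lexicographically. *)
pose M := (\max_(A : {set X}) w A).+1.
have ltM A : w A < M by rewrite ltnS (bigop.leq_bigmax A).
have lt_lex A A' : r (p @: A) < r (p @: A') ->
    r (p @: A) * M + w A < r (p @: A') * M + w A'.
  move=> lt_r; apply: (@leq_trans ((r (p @: A)).+1 * M)); last first.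
    by rewrite (leq_trans _ (leq_addr _ _)) // leq_mul2r lt_r orbT.
  by rewrite mulSn addnC ltn_add2r.
exists (fun A => r (p @: A) * M + w A) => F F'; rewrite !facet_blowup //.
move=> /andP[DF fF] /andP[DF' fF'] neqF le_r.
have /blowupP[sF injF EF] := DF; have /blowupP[sF' injF' EF'] := DF'.
(* If the projections differ, the exchange in [E] removes some [v = p x] from [p @: F], and the
   facet [G] it provides is lifted to a facet containing [F :\ x]. *)
have [eqp|neqp] := eqVneq (p @: F) (p @: F'); last first.
  have [|v] := sh _ _ fF fF' neqp.
    by rewrite leqNgt; apply: contraL le_r => /lt_lex; rewrite -ltnNge.
  rewrite inE => /andP[vF' /imsetP[x xF eqv]] [G [fG lt_r eqG]].
  have xF' : x \notin F' by apply: contra vF'; rewrite eqv; apply: imset_f.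
  exists x; first by rewrite inE xF' xF.
  have DFx : F :\ x \in blowup S E.
    exact: (@simplicial_complex_blowup S E cE) (subD1set _ _) DF.
  have [|F'' [DF'' sF'' eqF'']] := blowup_lift cE ES DFx (facet_mem fG).
    apply/subsetP=> _ /imsetP[y /setD1P[neqyx yF] ->]; apply: contraT => yG.
    have : p y \in p @: F :\: G by rewrite inE yG imset_f.
    rewrite eqG in_set1 eqv => /eqP eqyx.
    by case/eqP: neqyx; apply: injF.
  exists F''; rewrite facet_blowup // DF'' eqF''; split=> //.
    by rewrite -eqF'' lt_lex // eqF''.
  have vG : v \notin G.
    by have /setDP[] : v \in p @: F :\: G by rewrite eqG set11.
  apply/setP=> y; rewrite !inE; have [->|neqy] := eqVneq y x.
    by rewrite xF andbT; apply: contra vG; rewrite -eqF'' eqv; apply: imset_f.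
  have [yF|yF] := boolP (y \in F); last by rewrite andbF.
  by rewrite (subsetP sF'') // !inE neqy.
move: le_r; rewrite eqp leq_add2l => le_w.
(* With equal projections only the weights matter. They are split by fibers: for a face [A], at most
   one point contributes to [wv A v]. *)
pose wv (A : {set X}) v := \sum_(x in A | p x == v) c x.
have w_wv A : w A = \sum_v wv A v by rewrite /w (partition_big p predT).
have wvE A x : {in A &, injective p} -> x \in A -> wv A (p x) = c x.
  move=> injA xA; rewrite /wv (big_pred1 x) // => y /=.
  apply/andP/eqP => [[yA /eqP eqyx]|->]; first exact: injA.
  by rewrite xA eqxx.
have over A A' y : p @: A = p @: A' -> y \in A -> exists2 z, z \in A' & p y = p z.
  by move=> eqA yA; apply/imsetP; rewrite -eqA imset_f.
(* Otherwise [F] weighs at most as much as [F'] above every vertex. The totals compare the other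
   way, so all these weights agree, and [F = F'] since [c] is injective. *)
have [v lt_v] : exists v, wv F' v < wv F v.
  apply/existsP; apply: contraNT neqF => /existsPn le_v.
  have le_vv v : wv F v <= wv F' v by rewrite leqNgt le_v.
  have := leqif_sum (fun v (_ : predT v) => leqif_eq (le_vv v)).
  rewrite -!w_wv => leif_w; have /forall_inP eq_v : [forall (v | predT v), wv F v == wv F' v].
    by rewrite -(eq_leqif leif_w) eqn_leq le_w leif_w.
  rewrite eqEcard -(card_in_imset injF) -(card_in_imset injF') eqp leqnn andbT.
  apply/subsetP=> x xF; have [y yF' eqy] := over _ _ _ eqp xF.
  suff -> : x = y by [].
  apply: c_inj; rewrite -(wvE _ _ injF xF) -(wvE _ _ injF' yF') -eqy.
  by apply/eqP; apply: eq_v.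
have [x /andP[xF /eqP pxv]] : exists x, (x \in F) && (p x == v).
  apply/existsP; apply: contraLR lt_v => /existsPn noF.
  by rewrite -leqNgt [wv F v]big_pred0 ?leq0n // => x; apply: negbTE (noF x).
have [y yF' eqpxy] := over _ _ _ eqp xF.
have lt_c : c y < c x.
  by rewrite -(wvE _ _ injF xF) -(wvE _ _ injF' yF') -eqpxy pxv.
have neqxy : x != y by apply: contraTneq lt_c => ->; rewrite ltnn.
have xF' : x \notin F' by apply: contraNN neqxy => xF'; apply/eqP; apply: injF'.
have yF : y \notin F by apply: contraNN neqxy => yF; apply/eqP; apply: injF.
exists x; first by rewrite inE xF xF'.
have eqF'' : p @: (y |: F :\ x) = p @: F.
  by rewrite imsetU1 -eqpxy -imsetU1 setD1K.
(* Replacing [x] by the smaller [y] keeps the projection and lowers the weight. *)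
exists (y |: F :\ x); rewrite facet_blowup // eqF'' fF andbT; split.
- apply: blowup_setU1.
  + exact: subsetP yF'.
  + apply/imsetP=> -[z /setD1P[neqz zF] eqz]; case/eqP: neqz.
    by apply: injF; rewrite // -eqz.
  + exact: (@simplicial_complex_blowup S E cE) (subD1set _ _) DF.
  + by rewrite -imsetU1 eqF''.
- rewrite eqp ltn_add2l /w big_setU1 ?inE ?negb_and ?yF ?orbT //=.
  by rewrite [X in _ < X](big_setD1 x) //= ltn_add2r.
- apply/setP=> z; rewrite !inE; have [->|neqz] := eqVneq z x.
    by rewrite (negPf neqxy) xF.
  by have [->|_] := eqVneq z y; [rewrite (negPf yF) | rewrite /= andNb].
Qed.

End Blowup.

(** * Joins of complexes on disjoint copies of a vertex set *)

Section Join.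
Variables (I T : finType).
Implicit Types (A : {set I * T}) (D : I -> {set {set T}}) (B : I -> {set T}).
Implicit Types (E : {set {set T}}) (i j : I).

Definition fiber A i : {set T} := [set t | (i, t) \in A].

Definition glue B : {set I * T} := [set x | x.2 \in B x.1].

Definition upd (U : Type) (f : I -> U) i u j := if j == i then u else f j.

Definition join D : {set {set I * T}} := [set A | [forall i, fiber A i \in D i]].

Lemma updE (U : Type) (f : I -> U) i u : upd f i u i = u.
Proof. by rewrite /upd eqxx. Qed.

Lemma joinP D A : reflect (forall i, fiber A i \in D i) (A \in join D).
Proof. by rewrite inE; apply: forallP. Qed.

Lemma in_fiber A i t : (t \in fiber A i) = ((i, t) \in A).
Proof. by rewrite inE. Qed.

Lemma fiber_glue B i : fiber (glue B) i = B i.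
Proof. by apply/setP=> t; rewrite !inE. Qed.

Lemma fiber0 i : fiber set0 i = set0.
Proof. by apply/setP=> t; rewrite !inE. Qed.

Lemma fiber_inj A A' : (forall i, fiber A i = fiber A' i) -> A = A'.
Proof.
by move=> eqf; apply/setP=> -[i t]; rewrite -!in_fiber eqf.
Qed.

Lemma fiberS A A' i : A \subset A' -> fiber A i \subset fiber A' i.
Proof. by move/subsetP=> sA; apply/subsetP=> t; rewrite !in_fiber => /sA. Qed.

Lemma fiber_sub A A' :
  (forall i, fiber A i \subset fiber A' i) -> A \subset A'.
Proof.
move=> sA; apply/subsetP=> -[i t]; rewrite -!in_fiber; exact: subsetP.
Qed.

Lemma card_fibers A : #|A| = \sum_i #|fiber A i|.
Proof.
rewrite -sum1_card (eq_bigl (fun x => predT x.1 && ((x.1, x.2) \in A))); last first.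
  by case.
rewrite -(pair_big_dep predT (fun i t => (i, t) \in A) (fun _ _ => 1)) /=.
apply: eq_bigr => i _; rewrite -sum1_card; apply: eq_bigl => t.
by rewrite in_fiber.
Qed.

Lemma eq_join D D' : (forall i, D i = D' i) -> join D = join D'.
Proof.
move=> eqD; apply/setP=> A; rewrite !inE; apply: eq_forallb => i.
by rewrite eqD.
Qed.

Lemma simplicial_complex_join D :
  (forall i, simplicial_complex (D i)) -> simplicial_complex (join D).
Proof.
move=> cD A A' sA /joinP DA'; apply/joinP=> i.
by apply: cD (DA' i); apply: fiberS.
Qed.

(** The fibers of a face can be enlarged independently of each other. *)
Lemma facet_join D A :
  reflect (forall i, fiber A i \in facets (D i)) (A \in facets (join D)).
Proof.
apply: (iffP (@facetP _ _ _)) => [[/joinP DA maxA] i|fA].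
  apply/facetP; split=> // B DB sAB.
  rewrite -[in RHS](maxA (glue (upd (fiber A) i B))) ?fiber_glue ?updE //.
    by apply/joinP=> j; rewrite fiber_glue /upd; case: eqP => [->|].
  by apply: fiber_sub => j; rewrite fiber_glue /upd; case: eqP => [->|].
split=> [|A' /joinP DA' sA]; first by apply/joinP=> i; apply: facet_mem.
apply: fiber_inj => i; have /facetP[_ maxA] := fA i.
by apply: maxA => //; apply: fiberS.
Qed.

Lemma facet_glue D A i F : A \in facets (join D) -> F \in facets (D i) ->
  glue (upd (fiber A) i F) \in facets (join D).
Proof.
move=> /facet_join fA fF; apply/facet_join=> j; rewrite fiber_glue /upd.
by case: eqP => [->|].
Qed.

Lemma join_facet_exists D : (forall i, set0 \in D i) ->
  exists A, A \in facets (join D).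
Proof.
move=> D0; have [|A fA _] := @facet_exists _ (join D) set0; last by exists A.
by apply/joinP=> i; rewrite fiber0.
Qed.

Lemma pure_join D : (forall i, pure (D i)) -> pure (join D).
Proof.
move=> pD F F' /facet_join fF /facet_join fF'; rewrite !card_fibers.
by apply: eq_bigr => i _; apply: pD.
Qed.

(** Two facets of [D i] are glued into the same facet of the join; the sizes of the fibers away from
    [i] then cancel. *)
Lemma pure_join_factor D i : (forall j, set0 \in D j) -> pure (join D) ->
  pure (D i).
Proof.
move=> D0 pD F F' fF fF'; have [A fA] := join_facet_exists D0.
have := pD _ _ (facet_glue fA fF) (facet_glue fA fF').
rewrite !card_fibers (bigD1 i) //= [in RHS](bigD1 i) //= !fiber_glue !updE.
under eq_bigr => j /negPf neqj do rewrite fiber_glue /upd neqj.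
under [in RHS]eq_bigr => j /negPf neqj do rewrite fiber_glue /upd neqj.
by move/addIn.
Qed.

Lemma del_join D i t :
  del (join D) (i, t) = join (upd D i (del (D i) t)).
Proof.
apply/setP=> A; rewrite mem_del; apply/andP/joinP => [[/joinP DA itA] j|DA].
  by rewrite /upd; case: eqP => [->|] //; rewrite mem_del DA in_fiber.
have := DA i; rewrite updE mem_del in_fiber => /andP[DAi itA].
split=> //; apply/joinP=> j; have := DA j; rewrite /upd.
by case: eqP => [->|].
Qed.

Lemma fiber_setU1 A i t j :
  fiber ((i, t) |: A) j = upd (fiber A) i (t |: fiber A i) j.
Proof.
apply/setP=> u; rewrite /upd; case: eqP => [->|/eqP/negPf neqj].
  by rewrite !inE xpair_eqE eqxx.
by rewrite !inE xpair_eqE neqj.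
Qed.

Lemma link_join D i t : (forall j, simplicial_complex (D j)) ->
  link (join D) (i, t) = join (upd D i (link (D i) t)).
Proof.
move=> cD; have cJ := simplicial_complex_join cD.
apply/setP=> A; rewrite mem_link //; apply/andP/joinP => [[itA /joinP DA] j|DA].
  have := DA j; rewrite fiber_setU1 /upd; case: eqP => [->|] //.
  by rewrite mem_link // in_fiber itA.
have := DA i; rewrite updE mem_link // in_fiber => /andP[itA DAi].
split=> //; apply/joinP=> j; rewrite fiber_setU1.
by have := DA j; rewrite /upd; case: eqP => [->|].
Qed.

Lemma join_set0 : join (fun=> [set set0]) = [set set0].
Proof.
apply/setP=> A; rewrite in_set1; apply/joinP/eqP => [A0|-> i]; last first.
  by rewrite fiber0 set11.
by apply: fiber_inj => i; rewrite fiber0; apply/eqP; rewrite -in_set1.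
Qed.

(** Shedding [(i, t)] changes only the factor [D i], into its deletion or link. The induction
    hypothesis thus gives the other factors directly, and [D i] by shedding [t]. *)
Lemma vd_join_factor D : (forall i, simplicial_complex (D i)) ->
    (forall i, set0 \in D i) -> vertex_decomposable (join D) ->
  forall i, vertex_decomposable (D i).
Proof.
move=> cD D0 vJ; have cJ := simplicial_complex_join cD.
move: {-1}(join D) (erefl (join D)) cJ vJ => J eqJ cJ vJ.
move: J cJ vJ D eqJ cD D0.
apply: vd_ind0 => [|J [i t] _ pJ Jx _ IHdel _ IHlink] D eqJ cD D0 j.
  suff -> : D j = [set set0] by apply: vd_set0.
  apply/setP=> F; rewrite in_set1; apply/idP/eqP => [DF|->] //.
  have : glue (upd (fun=> set0) j F) \in join D.
    by apply/joinP=> k; rewrite fiber_glue /upd; case: eqP => [->|].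
  rewrite eqJ in_set1 => /eqP/(congr1 (fiber^~ j)).
  by rewrite /= fiber_glue updE fiber0.
rewrite -{}eqJ in pJ Jx IHdel IHlink.
have Dt : [set t] \in D i.
  have -> : [set t] = fiber [set (i, t)] i.
    by apply/setP=> u; rewrite !inE xpair_eqE eqxx.
  by have /joinP := Jx.
have vdel k : vertex_decomposable (upd D i (del (D i) t) k).
  apply: IHdel; rewrite ?del_join // => l; rewrite /upd; case: eqP => // _.
    exact: simplicial_complex_del.
  by rewrite mem_del D0 inE.
have vlink k : vertex_decomposable (upd D i (link (D i) t) k).
  apply: IHlink; rewrite ?link_join // => l; rewrite /upd; case: eqP => // _.
    exact: simplicial_complex_link.
  by rewrite mem_link // setU0 Dt inE.
have [->|/negPf neqj] := eqVneq j i; last by have := vdel j; rewrite /upd neqj.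
apply: (@vd_shed _ _ t) => //; first exact: pure_join_factor.
  by have := vdel i; rewrite updE.
by have := vlink i; rewrite updE.
Qed.

(** The factor [E] is decomposed inside the join until it is reduced to [[set set0]], where the
    hypothesis on the join applies. *)
Lemma vd_join_upd D i E : (forall j, simplicial_complex (D j)) ->
    (forall j, set0 \in D j) -> (forall j, pure (D j)) ->
    simplicial_complex E -> vertex_decomposable E ->
  vertex_decomposable (join (upd D i [set set0])) ->
  vertex_decomposable (join (upd D i E)).
Proof.
move=> cD D0 pD cE vE vJ.
move: E cE vE; apply: vd_ind0 => // E t cE pE Et _ IHdel _ IHlink.
have upd2 E' : join (upd (upd D i E) i E') = join (upd D i E').
  by apply: eq_join => j; rewrite /upd; case: eqP.
apply: (@vd_shed _ _ (i, t)).
- by apply: pure_join => j; rewrite /upd; case: eqP.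
- apply/joinP=> j; rewrite -[[set _]]setU0 fiber_setU1 !fiber0 setU0 /upd fiber0.
  by case: eqP.
- by rewrite del_join updE upd2.
- rewrite link_join ?updE ?upd2 // => j.
  by rewrite /upd; case: eqP.
Qed.

Lemma vd_join D : (forall i, simplicial_complex (D i)) ->
  (forall i, set0 \in D i) -> (forall i, vertex_decomposable (D i)) ->
  vertex_decomposable (join D).
Proof.
move=> cD D0 vD.
(* Factors outside [s] are replaced by [[set set0]], which is neutral for the join; the true factors
   are then restored one at a time. *)
pose part (s : seq I) i := if i \in s then D i else [set set0].
have c1 : simplicial_complex [set (set0 : {set T})].
  by move=> A B sAB; rewrite !in_set1 => /eqP B0; rewrite -subset0 -B0.
suff vpart s : vertex_decomposable (join (part s)).
  have -> // : join D = join (part (enum I)).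
  by apply: eq_join => i; rewrite /part mem_enum.
elim: s => [|i s IHs]; first by rewrite [join _]join_set0; apply: vd_set0.
have [si|si] := boolP (i \in s).
  have -> // : join (part (i :: s)) = join (part s).
  by apply: eq_join => j; rewrite /part inE; have [->|] := eqVneq j i; rewrite ?si.
have -> : join (part (i :: s)) = join (upd (part s) i (D i)).
  apply: eq_join => j; rewrite /part /upd inE.
  by have [->|] := eqVneq j i.
have p0 : pure [set (set0 : {set T})] := vd_pure (vd_set0 T).
apply: vd_join_upd => //.
- by move=> j; rewrite /part; case: ifP.
- by move=> j; rewrite /part; case: ifP => // _; rewrite set11.
- by move=> j; rewrite /part; case: ifP => // _; apply: vd_pure.
have -> // : join (upd (part s) i [set set0]) = join (part s).
by apply: eq_join => j; rewrite /upd /part; case: eqP => // ->; rewrite (negPf si).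
Qed.

(** A facet [A] of the join is fixed away from [i], and a facet of [D i] is ranked by the facet of
    the join that it completes. *)
Lemma shellable_join_factor D i : (forall j, set0 \in D j) ->
  shellable (join D) -> shellable (D i).
Proof.
move=> D0 /shellableP[pJ [r sh]]; apply/shellableP.
split; first exact: pure_join_factor.
have [A fA] := join_facet_exists D0.
exists (fun F => r (glue (upd (fiber A) i F))) => F F' fF fF' neqF le_r.
have [|[j t]] := sh _ _ (facet_glue fA fF) (facet_glue fA fF') _ le_r.
  apply: contraNneq neqF => /(congr1 (fiber^~ i)) /=.
  by rewrite !fiber_glue !updE => ->.
rewrite in_setD -!in_fiber !fiber_glue.
have [->|/negPf neqj] := eqVneq j i; last by rewrite /upd neqj andNb.
rewrite !updE => tF [F'' [fF'' lt_r eqF'']]; exists t; first by rewrite inE.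
have eqF t' : ((t' \in F) && (t' \notin fiber F'' i)) = (t' == t).
  have /setP/(_ (i, t')) := eqF''.
  by rewrite in_set1 in_setD -!in_fiber fiber_glue updE xpair_eqE eqxx andbC.
exists (fiber F'' i); split; first by have /facet_join/(_ i) := fF''.
  (* Away from [i], the fibers of [F''] contain those of [A], because the only missing point lies
     over [i]; as the latter are facets, they coincide. *)
  suff -> : glue (upd (fiber A) i (fiber F'' i)) = F'' by [].
  apply: fiber_inj => k; rewrite fiber_glue /upd.
  case: eqP => [->|/eqP/negPf neqk] //.
  have /facet_join/(_ k)/facetP[Dk maxk] := fA.
  apply/esym/maxk; first by have /facet_join/(_ k)/facet_mem := fF''.
  apply/subsetP=> u uA; have /setP/(_ (k, u)) := eqF''.
  rewrite in_set1 in_setD -!in_fiber fiber_glue /upd neqk uA xpair_eqE neqk.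
  by rewrite andbT => /negbFE.
by apply/setP=> t'; rewrite in_set1 -eqF inE andbC.
Qed.

(* If [F'] does not come after [F] for the sum of the ranks, then some fiber of
   [F'] strictly precedes that of [F]; only this fiber of [F] is changed. *)
Lemma shellable_join D :
  (forall i, shellable (D i)) -> shellable (join D).
Proof.
move=> shD; apply/shellableP.
split; first by apply: pure_join => i; case: (shD i).
have [r sh] : exists r, forall i, shelling_rank (D i) (r i).
  apply: (@fin_all_exists _ _ (fun i => shelling_rank (D i))) => i.
  by case/shellableP: (shD i).
exists (fun A => \sum_i r i (fiber A i)) => F F' fF fF' neqF le_r.
have /facet_join fiF := fF; have /facet_join fiF' := fF'.
have [i neqi le_ri] : exists2 i, fiber F i != fiber F' i &
    r i (fiber F' i) <= r i (fiber F i).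
  have [/existsP[i /andP[neqi le_ri]]|/existsPn allP] := boolP
    [exists i, (fiber F i != fiber F' i) && (r i (fiber F' i) <= r i (fiber F i))].
    by exists i.
  (* Without such an [i], every fiber of [F] ranks at most as high as that of [F'], with equality
     only for equal fibers; comparing the sums then forces [F = F']. *)
  have le_i i : r i (fiber F i) <= r i (fiber F' i) ?= iff (fiber F i == fiber F' i).
    have := allP i; have [-> _|neqi] := eqVneq (fiber F i) (fiber F' i).
      exact/leqif_refl.
    rewrite /= -ltnNge => lt_i; split; first exact: ltnW.
    by rewrite ltn_eqF.
  have leif_r := leqif_sum (fun i (_ : predT i) => le_i i).
  have : [forall (i | predT i), fiber F i == fiber F' i].
    by rewrite -(eq_leqif leif_r) eqn_leq le_r leif_r.
  move/forall_inP=> eqf; case/eqP: neqF; apply: fiber_inj => i.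
  by apply/eqP/eqf.
have [t tF [G [fG lt_r eqG]]] := sh i _ _ (fiF i) (fiF' i) neqi le_ri.
exists (i, t); first by move: tF; rewrite !inE.
exists (glue (upd (fiber F) i G)); split; first exact: facet_glue.
  rewrite (bigD1 i) //= [X in _ < X](bigD1 i) //= fiber_glue updE.
  rewrite (eq_bigr (fun j => r j (fiber F j))) ?ltn_add2r // => j /negPf neqj.
  by rewrite fiber_glue /upd neqj.
apply/setP=> -[j u]; rewrite !inE /= /upd xpair_eqE.
have [->|neqj] := eqVneq j i; last by rewrite in_fiber andNb.
by have /setP/(_ u) := eqG; rewrite !inE.
Qed.

End Join.

(** * Independence complexes of lexicographical products *)

Section LexProduct.
Variables G H : sgraph.

Lemma IndP (K : sgraph) (W : {set K}) :
  reflect {in W &, forall x y, ~~ adj x y} (W \in Ind K).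
Proof.
rewrite inE; apply: (iffP forall_inP) => [indW x y xW yW|indW x xW].
  by have /forall_inP/(_ y yW) := indW x xW.
by apply/forall_inP=> y yW; apply: indW.
Qed.

Lemma set0_Ind (K : sgraph) : set0 \in Ind K.
Proof. by apply/IndP=> x y; rewrite inE. Qed.

(** Without edges in [G], adjacency occurs only within a fiber, where it is that of [H]. *)
Lemma Ind_lex_isolated : isolated G ->
  Ind (lex_product G H) = join (fun=> Ind H) :> {set {set G * H}}.
Proof.
move=> isoG; apply/setP=> A.
apply/(@IndP (lex_product G H) A)/joinP => [indA g|indA [g h] [g' h'] xA yA].
  apply/IndP=> h h'; rewrite !in_fiber => /indA/[apply].
  by rewrite /adj /= /lex_adj /= eqxx negb_or => /andP[].
rewrite /adj /= /lex_adj /= negb_or isoG /=.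
have [eqg|//] := eqVneq g g'; rewrite -eqg in yA.
by have /IndP -> := indA g; rewrite ?in_fiber.
Qed.

(** Distinct points of a fiber are adjacent, so [fst] is injective on independent sets; between
    fibers only adjacency in [G] matters. *)
Lemma Ind_lex_complete : (forall h h' : H, adj h h' = (h != h')) ->
  Ind (lex_product G H) = blowup fst setT (Ind G) :> {set {set G * H}}.
Proof.
move=> cH; apply/setP=> A; apply/(@IndP (lex_product G H) A)/blowupP.
  move=> indA; split; first exact: subsetT.
    move=> [g h] [g' h'] xA yA /= eqg; rewrite -{}eqg in yA *.
    have := indA _ _ xA yA; rewrite /adj /= /lex_adj /= adj_irr eqxx cH /=.
    by rewrite negbK => /eqP->.
  apply/IndP=> _ _ /imsetP[x xA ->] /imsetP[y yA ->].
  by have := indA _ _ xA yA; rewrite {1}/adj /= /lex_adj negb_or => /andP[].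
case=> _ injA /IndP indA x y xA yA; rewrite /adj /= /lex_adj negb_or.
rewrite indA ?imset_f //=; have [eqxy|//] := eqVneq x.1 y.1.
by rewrite (injA _ _ xA yA eqxy) adj_irr.
Qed.

Lemma graph_iso_completeP :
  (exists m, graph_iso H (complete_graph m)) <->
  (forall h h' : H, adj h h' = (h != h')).
Proof.
split=> [[m [f /bij_inj f_inj fE]] h h'|cH].
  by rewrite -fE /= /complete_adj (inj_eq f_inj).
exists #|H|, enum_rank => [|x y]; first exact: enum_rank_bij.
by rewrite /= /complete_adj (inj_eq enum_rank_inj) cH.
Qed.

Lemma graph_iso_complete_pos : 0 < #|H| ->
  (exists m, graph_iso H (complete_graph m)) ->
  exists2 m, 1 <= m & graph_iso H (complete_graph m).
Proof.
move=> H_gt0 [m isoH]; exists m => //.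
have [f /bij_eq_card eqc _] := isoH.
by rewrite -(card_ord m) -eqc.
Qed.

(* Purity forces at least two points in the fiber, as the whole fiber could be
   replaced by [{h1, h2}]. *)
Lemma lex_facet_fiber (h1 h2 : H) (F : {set lex_product G H}) (x : G * H) :
    h1 != h2 -> ~~ adj h1 h2 -> pure (Ind (lex_product G H)) ->
    F \in facets (Ind (lex_product G H)) -> x \in F ->
  exists2 y : G * H, y \in F & (y != x) && (y.1 == x.1).
Proof.
move=> neqh nadjh pI fF xF; have /IndP indF := facet_mem fF.
apply/exists_inP; apply: contraT => /exists_inPn uniqF.
pose F' : {set lex_product G H} := (x.1, h1) |: ((x.1, h2) |: F :\ x).
have notF h : (x.1, h) \notin F :\ x.
  rewrite !inE; apply/andP=> -[neqx xhF].
  by have := uniqF _ xhF; rewrite neqx eqxx.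
have : #|F'| <= #|F|.
  apply: (leq_card_facet pI fF); apply/IndP.
  (* The other points of [F] lie in other fibers, where adjacency to [(x.1, h)] does not depend on
     [h]. *)
  have adjF h y : y \in F :\ x -> ~~ adj ((x.1, h) : lex_product G H) y.
    case/setD1P=> neqy yF; have := indF _ _ xF yF.
    rewrite /adj /= /lex_adj /= !negb_or => /andP[-> _] /=.
    rewrite negb_and; apply/orP; left.
    by have := uniqF y yF; rewrite neqy /= eq_sym.
  have adjx h h' : ~~ adj h h' ->
      ~~ adj ((x.1, h) : lex_product G H) (x.1, h').
    by move=> hh'; rewrite /adj /= /lex_adj /= adj_irr eqxx.
  move=> y z; rewrite !in_setU1.
  case/or3P=> [/eqP->|/eqP->|yF]; case/or3P=> [/eqP->|/eqP->|zF].
  - by rewrite adj_irr.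
  - exact: adjx.
  - exact: adjF.
  - by rewrite adj_sym adjx.
  - by rewrite adj_irr.
  - exact: adjF.
  - by rewrite adj_sym adjF.
  - by rewrite adj_sym adjF.
  - by apply: indF; [case/setD1P: yF | case/setD1P: zF].
rewrite cardsU1 cardsU1 in_setU1 negb_or !notF xpair_eqE eqxx neqh /=.
by rewrite (cardsD1 x F) xF ltnn.
Qed.

Lemma lex_shellable_complete : ~ isolated G ->
  shellable (Ind (lex_product G H)) -> forall h h' : H, adj h h' = (h != h').
Proof.
move=> isoG /shellableP[pI [r sh]] h1 h2.
have [->|neqh] := eqVneq h1 h2; first exact: adj_irr.
apply/idP; apply: contraT => nadjh.
have [x [y adjxy]] : exists x y : G, adj x y.
  have [/existsP[x /existsP[y]]|/existsPn noadj] :=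
    boolP [exists x : G, exists y : G, adj x y]; first by exists x, y.
  by case: isoG => x y; have /existsPn := noadj x.
pose pr (F : {set lex_product G H}) := [set z.1 | z in F].
(* A point of [F] outside [F'] shares its fiber with a second point of [F], which lies in [F']
   because only one point is missing. *)
have pr_sub F F' z : F \in facets (Ind (lex_product G H)) ->
    F :\: F' = [set z] -> pr F \subset pr F'.
  move=> fF eqz; apply/subsetP=> _ /imsetP[t tF ->].
  have [tF'|tF'] := boolP (t \in F'); first exact: imset_f.
  have [t' t'F /andP[neqt' /eqP <-]] := lex_facet_fiber neqh nadjh pI fF tF.
  apply: imset_f; apply: contraNT neqt' => t'F'.
  have -> : t = z by apply/eqP; rewrite -in_set1 -eqz inE tF'.
  by rewrite -in_set1 -eqz inE t'F'.
have pr_eq F F' z : F \in facets (Ind (lex_product G H)) ->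
    F' \in facets (Ind (lex_product G H)) ->
    F :\: F' = [set z] -> pr F = pr F'.
  (* By purity [F' :\: F] is also a single point, so the inclusion holds both ways. *)
  move=> fF fF' eqz; apply/eqP; rewrite eqEsubset (pr_sub F F' z) //=.
  have /cards1P[z' eqz'] : #|F' :\: F| == 1.
    rewrite -(eqn_add2l #|F' :&: F|) cardsID setIC (pI _ _ fF' fF).
    by rewrite -(cards1 z) -eqz cardsID.
  exact: (pr_sub F' F z').
have [F0 fF0 minF0] : exists2 F0, F0 \in facets (Ind (lex_product G H)) &
    forall F, F \in facets (Ind (lex_product G H)) -> r F0 <= r F.
  have [F0 fF0 _] := facet_exists (set0_Ind (lex_product G H)).
  by case: (arg_minnP r fF0) => F fF minF; exists F.
(* Induction on the rank: the exchange against [F0], of minimal rank, yields a facet of smaller rank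
   with the same projection. *)
have pr_const F : F \in facets (Ind (lex_product G H)) -> pr F = pr F0.
  have [n] := ubnP (r F); elim: n F => // n IHn F leFn fF.
  have [->//|neqF] := eqVneq F F0.
  have [z _ [F' [fF' lt_r eqz]]] := sh _ _ fF fF0 neqF (minF0 _ fF).
  by rewrite (pr_eq _ _ _ fF fF' eqz) IHn // (leq_trans lt_r).
have pr_mem (g : G) : exists2 F, F \in facets (Ind (lex_product G H)) & g \in pr F.
  have [|F fF] := @facet_exists _ (Ind (lex_product G H)) [set (g, h1)].
    by apply/IndP=> u v; rewrite !inE => /eqP-> /eqP->; rewrite adj_irr.
  by rewrite sub1set => gF; exists F => //; apply/imsetP; exists (g, h1).
(* Both ends of an edge of [G] now lie in the projection of [F0], so this independent set contains
   two adjacent points. *)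
have [F fF xF] := pr_mem x; have [F' fF' yF'] := pr_mem y.
move: xF yF'; rewrite (pr_const F) // (pr_const F') //.
case/imsetP=> u uF xu /imsetP[v vF yv].
have /IndP/(_ u v uF vF) := facet_mem fF0.
by rewrite {1}/adj /= /lex_adj -xu -yv adjxy.
Qed.

End LexProduct.

(** * Combination of the cases of [G] without edges and [G] with an edge *)

Theorem theorem1p1 (G H : sgraph) (G_neq0 : 0 < #|G|) (H_neq0 : 0 < #|H|) :
  [/\ isolated G ->
        (vertex_decomposable (Ind H) <->
           vertex_decomposable (Ind (lex_product G H))) /\
        (shellable (Ind H) <-> shellable (Ind (lex_product G H))),
      ~ isolated G ->
        (vertex_decomposable (Ind (lex_product G H)) <->
           vertex_decomposable (Ind G) /\
           exists2 m : nat, 1 <= m & graph_iso H (complete_graph m))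
    & ~ isolated G ->
        (forall m : nat, shellable (Ind G) -> graph_iso H (complete_graph m) ->
           shellable (Ind (lex_product G H))) /\
        (shellable (Ind (lex_product G H)) ->
           exists2 m : nat, 1 <= m & graph_iso H (complete_graph m))].
Proof.
have cInd (K : sgraph) := @simplicial_complex_Ind K.
have [g _] := card_gt0P G_neq0; have [h _] := card_gt0P H_neq0.
(* The point [h] supplies a vertex of the product above each vertex of [G], as the blow-up lemmas
   require. *)
have subG (C : {set G}) : C \in Ind G -> C \subset [set x.1 | x in [set: G * H]].
  by move=> _; apply/subsetP=> x _; apply/imsetP; exists (x, h).
have complete_iso : (forall x y : H, adj x y = (x != y)) ->
    exists2 m : nat, 1 <= m & graph_iso H (complete_graph m).
  by move=> /graph_iso_completeP; apply: graph_iso_complete_pos.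
split=> isoG.
- rewrite Ind_lex_isolated //; split; split.
  + by move=> vH; apply: vd_join => // i; apply: set0_Ind.
  + by move/vd_join_factor; apply=> // i; apply: set0_Ind.
  + by move=> sH; apply: shellable_join.
  + by move/shellable_join_factor; apply=> // i; apply: set0_Ind.
- split=> [vL|[vG [m _ isoH]]].
    (* Vertex decomposability implies shellability, which already forces [H] to be complete; the
       complex is then a blow-up of [Ind G]. *)
    have cH := lex_shellable_complete isoG (vd_shellable (@cInd _) vL).
    split; last exact: complete_iso.
    by move: vL; rewrite Ind_lex_complete //; apply: vd_blowup_base.
  rewrite Ind_lex_complete; last by apply/graph_iso_completeP; exists m.
  exact: vd_blowup.
split=> [m sG isoH|/(lex_shellable_complete isoG)]; last exact: complete_iso.
rewrite Ind_lex_complete; last by apply/graph_iso_completeP; exists m.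
exact: shellable_blowup.
Qed.
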